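(* Let $N\ge 1$ and $M$ be integers with $0\le M\le N-1$, and let $f\in\mathcal M_N'$, $\psi\in\mathcal M_N$. Then the $\sigma$-indexed family of functions $$w\longmapsto\sigma^{M+1}\left(f*\psi_\sigma(\sigma w)-\sum_{n=0}^{M}\frac{(-1)^n}{n!}\,\mu_n\,\sigma^{-n-1}\,\psi^{(n)}(w)\right)$$ converges locally uniformly in $w\in\mathbb R$ (i.e. uniformly on compact subsets) to the zero function as $\sigma\to\infty$, where $\mu_n=\langle f,x^n\rangle$ is the $n$th moment of $f$.
   Context: For an integer $N\ge0$, $\mathcal M_N$ is the space of smooth functions $\psi$ on $\mathbb R$ such that for each integer $n\ge0$ the seminorm $\|\psi\|_{N,n}=\sup_{x\in\mathbb R}(1+|x|)^{-(N-n)}|\psi^{(n)}(x)|$ is finite, with the topology generated by the seminorms $\|\cdot\|_{N,n}$, $n\ge0$; $\mathcal M_N'$ is its topological dual. In particular $x^m\in\mathcal M_N$ for integers $0\le m\le N$, so an element of $\mathcal M_N'$ has moments through order $N$. For $\sigma>0$, $\psi_\sigma(x)=\sigma^{-1}\psi(x/\sigma)$ and $f*\psi_\sigma(x)=\langle f,\psi_\sigma(x-\cdot)\rangle$. *)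

(* Defs.v *)
From HB Require Import structures.
From mathcomp Require Import all_boot all_order all_algebra.
From mathcomp Require Import complex ring lra.
From mathcomp Require Import all_classical all_reals all_analysis.
Import numFieldNormedType.Exports.
Set Implicit Arguments.
Unset Strict Implicit.
Unset Printing Implicit Defensive.
Import Order.TTheory GRing.Theory Num.Theory.
Local Open Scope classical_set_scope.
Local Open Scope complex_scope.
Local Open Scope ring_scope.

Section real_smooth.
Context {R : realType}.
Implicit Types f g : R -> R.

Definition rsmooth f := forall n x, derivable (derive1n n f) x 1.

Lemma derive1n_lin (a b : R) f g n : rsmooth f -> rsmooth g ->
  derive1n n (fun x => a * f x + b * g x) =
  (fun x => a * derive1n n f x + b * derive1n n g x).
Proof.
move=> sf sg; elim: n => [//|n IH].
rewrite derive1nS IH; apply/funext => x; rewrite !derive1nS !derive1E.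
have -> : (fun y => a * derive1n n f y + b * derive1n n g y) =
  (a *: derive1n n f + b *: derive1n n g) by apply/funext.
have dZ k h : rsmooth h -> derivable (k *: derive1n n h) x 1.
  by move=> sh; apply: derivableZ; exact: sh.
rewrite (deriveD (dZ a f sf) (dZ b g sg)).
by rewrite (deriveZ a (sf n x)) (deriveZ b (sg n x)).
Qed.

Lemma rsmooth_lin (a b : R) f g : rsmooth f -> rsmooth g ->
  rsmooth (fun x => a * f x + b * g x).
Proof.
move=> sf sg n x; rewrite (derive1n_lin _ _ _ sf sg).
have -> : (fun y => a * derive1n n f y + b * derive1n n g y) =
  (a *: derive1n n f + b *: derive1n n g) by apply/funext.
apply: derivableD; apply: derivableZ; [exact: sf | exact: sg].
Qed.

Lemma is_derive_affine (c d x : R) : is_derive x 1 (fun z : R => c * z + d) c.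
Proof.
have -> : (fun z : R => c * z + d) = (c *: id + cst d) by apply/funext.
by apply: is_derive_eq; rewrite addr0 /GRing.scale /= mulr1.
Qed.

Lemma is_derive_comp_affine (c d x : R) f :
  derivable f (c * x + d) 1 ->
  is_derive x 1 (fun z => f (c * z + d)) (c * derive1 f (c * x + d)).
Proof.
move=> df; have daff := @ex_derive _ _ _ _ _ _ _ (is_derive_affine c d x).
apply: DeriveDef.
  apply/derivable1_diffP; apply: (@differentiable_comp _ _ _ _ _ f).
    exact: (derivable1_diffP _ _).1 daff.
  exact: (derivable1_diffP _ _).1 df.
rewrite -derive1E (derive1_comp daff df) mulrC; congr (_ * _).
by rewrite derive1E (@derive_val _ _ _ _ _ _ _ (is_derive_affine c d x)).
Qed.

Lemma derive1n_affine (c d : R) f n : rsmooth f ->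
  derive1n n (fun x => f (c * x + d)) =
  (fun x => c ^+ n * derive1n n f (c * x + d)).
Proof.
move=> sf; elim: n => [|n IH]; first by apply/funext => x; rewrite expr0 mul1r.
rewrite derive1nS IH; apply/funext => x.
have D := is_derive_comp_affine (sf n (c * x + d)).
have -> : (fun y => c ^+ n * derive1n n f (c * y + d)) =
  (c ^+ n *: (fun z : R => derive1n n f (c * z + d))) by apply/funext.
rewrite derive1E (deriveZ _ (@ex_derive _ _ _ _ _ _ _ D)).
by rewrite (@derive_val _ _ _ _ _ _ _ D) exprSr -mulrA.
Qed.

Lemma rsmooth_affine (c d : R) f : rsmooth f -> rsmooth (fun x => f (c * x + d)).
Proof.
move=> sf n x; rewrite (derive1n_affine _ _ _ sf).
have D := is_derive_comp_affine (sf n (c * x + d)).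
have -> : (fun y => c ^+ n * derive1n n f (c * y + d)) =
  (c ^+ n *: (fun z : R => derive1n n f (c * z + d))) by apply/funext.
apply: derivableZ; exact: (@ex_derive _ _ _ _ _ _ _ D).
Qed.

Lemma derive1n_expr m n : derive1n n (fun x : R => x ^+ m) =
  (fun x => (m ^_ n)%:R * x ^+ (m - n)).
Proof.
elim: n => [|n IH]; first by apply/funext => x; rewrite ffactn0 mul1r subn0.
rewrite derive1nS IH; apply/funext => x.
have -> : (fun x0 : R => (m ^_ n)%:R * x0 ^+ (m - n)) =
  ((m ^_ n)%:R : R) *: ((@id R) ^+ (m - n)).
  by apply/funext => y; rewrite /GRing.scale /=; congr (_ * _); rewrite exprfctE.
rewrite derive1E deriveZ //= deriveX //= derive_id /GRing.scale /= mulr1.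
by rewrite ffactnSr natrM -!mulrA subnS mulr_natl.
Qed.

Lemma rsmooth_expr m : rsmooth (fun x : R => x ^+ m).
Proof.
move=> n x; rewrite derive1n_expr.
have -> : (fun x0 : R => (m ^_ n)%:R * x0 ^+ (m - n)) =
  ((m ^_ n)%:R : R) *: ((@id R) ^+ (m - n)).
  by apply/funext => y; rewrite /GRing.scale /=; congr (_ * _); rewrite exprfctE.
by apply: derivableZ; apply: derivableX.
Qed.

End real_smooth.

Local Notation re := (@complex.Re _).
Local Notation im := (@complex.Im _).
Local Notation normc := Normc.normc.

Section space_MN.
Context {R : realType}.
Implicit Types (psi phi : R -> R[i]^o) (N n : nat).

Definition csmooth psi := rsmooth (re \o psi) /\ rsmooth (im \o psi).

(* Derivatives of a complex-valued function of a real variable are taken on the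
   real and imaginary parts. *)
Definition cderive1n n psi (x : R) : R[i] :=
  derive1n n (re \o psi) x +i* derive1n n (im \o psi) x.

(* The weight carries an integer exponent, which is positive when n > N; the
   supremum lives in \bar R, so that finiteness is a genuine condition. *)
Definition MN_norm N n psi : \bar R :=
  ereal_sup [set ((1 + `|x|) ^ (- (N%:Z - n%:Z)) * normc (cderive1n n psi x))%:E
            | x in [set: R]].

Definition MN_prop N psi :=
  csmooth psi /\ forall n, (MN_norm N n psi < +oo)%E.

Definition MN_pred N : {pred R -> R[i]^o} := fun psi => `[< MN_prop N psi >].

Lemma MN_predP N psi : reflect (MN_prop N psi) (psi \in MN_pred N).
Proof. exact: asboolP. Qed.

Lemma MN_norm_ltyP N n psi : (MN_norm N n psi < +oo)%E <->
  exists B : R, forall x : R,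
    (1 + `|x|) ^ (- (N%:Z - n%:Z)) * normc (cderive1n n psi x) <= B.
Proof.
split=> [h|[B hB]]; last first.
  apply: (@le_lt_trans _ _ B%:E); last exact: ltry.
  by apply: ge_ereal_sup => _ [x _ <-]; rewrite lee_fin; exact: hB.
have ub x : (((1 + `|x|) ^ (- (N%:Z - n%:Z)) * normc (cderive1n n psi x))%:E
    <= MN_norm N n psi)%E by apply: ereal_sup_ubound; exists x.
case: (MN_norm N n psi) h ub => [r _ ub|//|_ ub].
- by exists r => x; rewrite -lee_fin.
- by have := ub 0; rewrite leeNy_eq.
Qed.

Lemma weight_ge0 (x : R) (z : int) : 0 <= (1 + `|x|) ^ z.
Proof. by apply: exprz_ge0; apply: addr_ge0. Qed.

Lemma normc_ge0 (z : R[i]) : 0 <= normc z.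
Proof. by case: z => a b; exact: sqrtr_ge0. Qed.

Lemma normcD_le (y z : R[i]) : normc (y + z) <= normc y + normc z.
Proof. by have := ler_normD y z; rewrite -lecR rmorphD. Qed.

Lemma Re_lin (c : R[i]) psi phi : re \o (c *: psi + phi) =
  (fun x => 1 * (re c * (re \o psi) x + (- im c) * (im \o psi) x) +
            1 * (re \o phi) x).
Proof.
apply/funext => x /=; rewrite !mul1r mulNr.
change (re (c * psi x + phi x) = re c * re (psi x) - im c * im (psi x) + re (phi x)).
by case: c (psi x) (phi x) => a b [u v] [s t].
Qed.

Lemma Im_lin (c : R[i]) psi phi : im \o (c *: psi + phi) =
  (fun x => 1 * (re c * (im \o psi) x + im c * (re \o psi) x) +
            1 * (im \o phi) x).
Proof.
apply/funext => x /=; rewrite !mul1r.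
change (im (c * psi x + phi x) = re c * im (psi x) + im c * re (psi x) + im (phi x)).
by case: c (psi x) (phi x) => a b [u v] [s t].
Qed.

Lemma csmooth_lin (c : R[i]) psi phi :
  csmooth psi -> csmooth phi -> csmooth (c *: psi + phi).
Proof.
move=> [s1 s2] [t1 t2]; rewrite /csmooth Re_lin Im_lin.
split; apply: rsmooth_lin; [|exact: t1| |exact: t2].
  exact: (rsmooth_lin s1 s2).
exact: (rsmooth_lin s2 s1).
Qed.

Lemma cderive1n_lin (c : R[i]) psi phi n : csmooth psi -> csmooth phi ->
  cderive1n n (c *: psi + phi) =
  (fun x => c * cderive1n n psi x + cderive1n n phi x).
Proof.
move=> [s1 s2] [t1 t2]; apply/funext => x.
have L a b (f g : R -> R) := @rsmooth_lin R a b f g.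
rewrite /cderive1n Re_lin Im_lin.
rewrite (derive1n_lin _ _ n (L _ _ _ _ s1 s2) t1).
rewrite (derive1n_lin _ _ n (L _ _ _ _ s2 s1) t2).
rewrite (derive1n_lin _ _ n s1 s2) (derive1n_lin _ _ n s2 s1) !mul1r mulNr.
by case: c => a b.
Qed.

Lemma MN_pred_submod N : submod_closed (MN_pred N).
Proof.
split.
  apply/MN_predP.
  have z0 : @rsmooth R (fun x => 0).
    have := rsmooth_lin (a:=0) (b:=0) (@rsmooth_expr R 0) (@rsmooth_expr R 0).
    by congr rsmooth; apply/funext => x; rewrite !mul0r addr0.
  have zn n x : derive1n n (fun _ : R => 0 : R) x = 0.
    have := derive1n_lin 0 0 n z0 z0.
    rewrite (_ : (fun x => _) = (fun=> 0)) => [->|].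
      by rewrite !mul0r addr0.
    by apply/funext => y; rewrite !mul0r addr0.
  split; first by split.
  move=> n; apply/MN_norm_ltyP; exists 0 => x.
  by rewrite /cderive1n !zn Normc.normc0 mulr0.
move=> c psi phi /MN_predP[s1 b1] /MN_predP[s2 b2]; apply/MN_predP.
split; first exact: csmooth_lin.
move=> n; apply/MN_norm_ltyP.
have /MN_norm_ltyP[B1 h1] := b1 n; have /MN_norm_ltyP[B2 h2] := b2 n.
exists (normc c * B1 + B2) => x; rewrite (cderive1n_lin c n s1 s2).
apply: le_trans (ler_wpM2l (weight_ge0 _ _) (normcD_le _ _)) _.
rewrite Normc.normcM mulrDr mulrCA.
by apply: lerD; [apply: ler_wpM2l => //; exact: normc_ge0 | exact: h2].
Qed.

HB.instance Definition _ N :=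
  GRing.isSubmodClosed.Build R[i] (R -> R[i]^o) (MN_pred N) (MN_pred_submod N).

End space_MN.

(* Elements are the functions with finite seminorms; the topology declared below
   has the seminorm balls of positive radius around all points as a subbase, and
   the scalars are complex. *)
Record MN (R : realType) (N : nat) :=
  MkMN { MN_fun :> R -> R[i]^o; _ : MN_fun \in MN_pred N }.

Section MN_structure.
Context {R : realType} (N : nat).
HB.instance Definition _ := [isSub for @MN_fun R N].
HB.instance Definition _ := [Choice of MN R N by <:].
HB.instance Definition _ := [SubChoice_isSubLmodule of MN R N by <:].

HB.instance Definition _ := isPointed.Build (MN R N) 0.

Definition MN_ball (i : MN R N * nat * R) : set (MN R N) :=
  [set phi : MN R N | (MN_norm N i.1.2 (phi - i.1.1)%R < i.2%:E)%E].

HB.instance Definition _ := isSubBaseTopological.Build (MN R N)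
  [set i : MN R N * nat * R | 0 < i.2] MN_ball.

End MN_structure.

Section pairing.
Context {R : realType} (N : nat).
Implicit Types (f : MN R N -> R[i]^o) (psi : R -> R[i]^o).

(* insubd sends a function outside the space to the zero test function; this
   default is never used for the functions below, by monomial_in and dilate_in. *)
Definition pairing f psi : R[i] := f (insubd 0 psi).

Definition monomial m : R -> R[i]^o := fun x => (x ^+ m)%:C.

Definition moment f n : R[i] := pairing f (monomial n).

Definition dilate (s : R) psi : R -> R[i]^o := fun x => s^-1%:C * psi (x / s).

Definition convolution f psi (x : R) : R[i] := pairing f (fun y => psi (x - y)).

Lemma pairingE f psi (psiP : psi \in MN_pred N) : pairing f psi = f (MkMN psiP).
Proof.
by congr (f _); apply: val_inj; rewrite val_insubd psiP.
Qed.

Lemma monomial_in m : (m <= N)%N -> monomial m \in MN_pred N.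
Proof.
move=> mN; apply/MN_predP.
have Hre : re \o monomial m = (fun x : R => x ^+ m) by apply/funext.
have Him : im \o monomial m = (fun x : R => 0 * x ^+ 0 + 0 * x ^+ 0).
  by apply/funext => x; rewrite !mul0r addr0.
have e0 := @rsmooth_expr R 0.
split; first by rewrite /csmooth Hre Him; split;
  [exact: rsmooth_expr | exact: (rsmooth_lin e0 e0)].
move=> n; apply/MN_norm_ltyP; exists (m ^_ n)%:R => x.
rewrite /cderive1n Hre Him (derive1n_lin _ _ n e0 e0) !mul0r addr0.
rewrite derive1n_expr /= expr0n addr0 sqrtr_sqr normrM normr_nat normrX.
have [nm|mn] := leqP n m; last by rewrite ffact_small// mul0r mulr0.
rewrite mulrCA ler_piMr //.
have h1 : 1 <= 1 + `|x| by rewrite lerDl.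
have h0 : 0 < 1 + `|x| by apply: lt_le_trans h1.
rewrite subzn ?(leq_trans nm mN)// -exprnN mulrC.
rewrite ler_pdivrMr ?exprn_gt0// mul1r.
apply: (@le_trans _ _ ((1 + `|x|) ^+ (m - n))).
  by apply: lerXn2r; rewrite ?nnegrE ?lerDr // ltW.
by apply: ler_weXn2l => //; exact: leq_sub2r.
Qed.

Lemma weight_affine (c d y : R) :
  1 + `|c * y + d| <= (1 + `|c| + `|d|) * (1 + `|y|).
Proof.
have h : `|c * y + d| <= `|c| * `|y| + `|d| by rewrite -normrM ler_normD.
have := normr_ge0 c; have := normr_ge0 d; have := normr_ge0 y.
move: h; set u := `|c * y + d|; set C := `|c|; set D := `|d|; set Y := `|y|.
by nra.
Qed.

Lemma weight_comp_affine (c d : R) (z : int) : c != 0 ->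
  exists2 K : R, 0 <= K &
    forall y : R, (1 + `|y|) ^ z <= K * (1 + `|c * y + d|) ^ z.
Proof.
move=> c0; pose w (x : R) := 1 + `|x|.
have w0 x : 0 < w x by apply: (@lt_le_trans _ _ 1); rewrite ?lerDl.
case: z => k.
  exists ((1 + `|c^-1| + `|- (d / c)|) ^+ k)=> [|y].
    by apply: exprn_ge0; rewrite !addr_ge0.
  rewrite -!exprnP -exprMn; apply: lerXn2r; rewrite ?nnegrE.
  - exact: ltW.
  - by rewrite mulr_ge0 ?addr_ge0.
  have := weight_affine c^-1 (- (d / c)) (c * y + d).
  suff -> : c^-1 * (c * y + d) + - (d / c) = y by [].
  by field.
exists ((1 + `|c| + `|d|) ^+ k.+1)=> [|y].
  by apply: exprn_ge0; rewrite !addr_ge0.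
rewrite NegzE -!exprnN ler_pdivlMr ?exprn_gt0//.
rewrite mulrC ler_pdivrMr ?exprn_gt0// -exprMn.
apply: lerXn2r; rewrite ?nnegrE; last exact: weight_affine.
- exact: ltW.
- by rewrite mulr_ge0 ?addr_ge0.
Qed.

(* The test function of the convolution at x lies in the space for s > 0. *)
Lemma dilate_in (s x : R) psi : 0 < s -> psi \in MN_pred N ->
  (fun y => dilate s psi (x - y)) \in MN_pred N.
Proof.
move=> s0 /MN_predP[[p1 p2] b]; apply/MN_predP.
pose c := - s^-1; pose d := x / s.
have c0 : c != 0 by rewrite oppr_eq0 invr_neq0// gt_eqF.
have E y : (x - y) / s = c * y + d by rewrite /c /d; field; rewrite gt_eqF.
pose p y : R[i]^o := psi (c * y + d).
have sp : csmooth p.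
  exact (conj (rsmooth_affine p1) (rsmooth_affine p2)).
suff pin : p \in MN_pred N.
  have -> : (fun y => dilate s psi (x - y)) = s^-1%:C *: p.
    by apply/funext => y; rewrite /dilate E.
  exact/MN_predP/rpredZ.
apply/MN_predP; split=> // n; apply/MN_norm_ltyP.
have /MN_norm_ltyP[B hB] := b n.
have [K K0 hK] := weight_comp_affine d (- (N%:Z - n%:Z)) c0.
exists (K * (`|c| ^+ n * B)) => y.
have -> : cderive1n n p y = (c ^+ n)%:C * cderive1n n psi (c * y + d).
  rewrite /cderive1n (derive1n_affine _ _ _ p1) (derive1n_affine _ _ _ p2).
  by rewrite /GRing.mul /= !mul0r subr0 addr0.
rewrite Normc.normcM /= expr0n addr0 sqrtr_sqr normrX.
apply: le_trans (ler_wpM2r _ (hK y)) _.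
  by apply: mulr_ge0; [exact: exprn_ge0|exact: sqrtr_ge0].
rewrite -mulrA ler_wpM2l// mulrCA ler_wpM2l// exprn_ge0//.
Qed.

End pairing.

(* Main.v *)
(* Let h_w,s(y) = s^(M+1) (psi_s(s w - y) - sum_(n <= M) (-1)^n/n! s^(-n-1)
   psi^(n)(w) y^n).  Applying f to h_w,s gives the quantity to be estimated, so
   by continuity of f it suffices that each seminorm of h_w,s is O(1/s),
   uniformly for w in a compact set.  The sum is the Taylor polynomial of
   y |-> psi_s(s w - y) at 0, so derivatives of h_w,s of order k <= M vanish at 0.
   Those of order k > M are multiples of psi^(k)(w - y/s), and the growth of
   psi^(k) bounds them by (C/s) (1 + |y|)^(N-k); as M < N, the mean value theorem
   transports this bound from order M+1 down to every lower order. *)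
Require Import Defs.
From mathcomp Require Import all_boot all_order all_algebra.
From mathcomp Require Import complex.
From mathcomp Require Import finmap ring lra.
From mathcomp Require Import all_classical all_reals all_analysis.
Import numFieldNormedType.Exports.
Import Order.TTheory GRing.Theory Num.Theory.
Local Open Scope classical_set_scope.
Local Open Scope complex_scope.
Local Open Scope ring_scope.

Local Notation re := (@complex.Re _).
Local Notation im := (@complex.Im _).
Local Notation normc := Normc.normc.

(** * Weighted bounds on Taylor remainders of dilated real functions *)

Section taylor_remainder.
Context {R : realType}.
Implicit Types (g h : R -> R) (a : nat -> R) (s w x y A : R).

Lemma derive1n_power_sum a m k :
  rsmooth (fun x => \sum_(0 <= n < m) a n * x ^+ n) /\
  derive1n k (fun x => \sum_(0 <= n < m) a n * x ^+ n) =
  (fun x => \sum_(0 <= n < m) a n * ((n ^_ k)%:R * x ^+ (n - k))).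
Proof.
elim: m => [|m [sm IH]].
  have e : (fun x => \sum_(0 <= n < 0) a n * x ^+ n) =
      (fun x => 0 * x ^+ 0 + 0 * x ^+ 0).
    by apply/funext => x; rewrite big_nil !mul0r addr0.
  rewrite e (derive1n_lin 0 0 k (@rsmooth_expr R 0) (@rsmooth_expr R 0)).
  split; first exact: rsmooth_lin (@rsmooth_expr R 0) (@rsmooth_expr R 0).
  by apply/funext => x; rewrite big_nil !mul0r addr0.
have -> : (fun x => \sum_(0 <= n < m.+1) a n * x ^+ n) =
    (fun x => 1 * (\sum_(0 <= n < m) a n * x ^+ n) + a m * x ^+ m).
  by apply/funext => x; rewrite big_nat_recr//= mul1r.
split; first exact: rsmooth_lin sm (@rsmooth_expr R m).
rewrite (derive1n_lin 1 (a m) k sm (@rsmooth_expr R m)) IH derive1n_expr.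
by apply/funext => x; rewrite big_nat_recr//= mul1r.
Qed.

(** Since [derive1n k g] vanishes at 0, its value at y is y times the next derivative at some c with
    |c| <= |y|; the factor |y| <= 1 + |y| raises the power by one and leaves [A] unchanged. *)
Lemma mean_value_growth g k m A : rsmooth g -> derive1n k g 0 = 0 ->
  (forall y, `|derive1n k.+1 g y| <= A * (1 + `|y|) ^+ m) ->
  forall y, `|derive1n k g y| <= A * (1 + `|y|) ^+ m.+1.
Proof.
move=> sg g0 gA y.
have A0 : 0 <= A by have := gA 0; rewrite normr0 addr0 expr1n mulr1; apply: le_trans.
have dg x : is_derive x (1 : R) (derive1n k g) (derive1n k.+1 g x).
  by rewrite derive1nS derive1E; apply/derivableP; exact: sg.
have cg (i : interval R) : {within [set` i], continuous (derive1n k g)}.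
  by apply: derivable_within_continuous => x _; exact: sg.
have [c cy ec] : exists2 c, `|c| <= `|y| & derive1n k g y = derive1n k.+1 g c * y.
  have [y0|y0] := leP 0 y.
    have [c] := MVT_segment y0 (fun x _ => dg x) (cg _).
    rewrite in_itv/= g0 !subr0 => /andP[c0 cy] e.
    by exists c => //; rewrite !ger0_norm.
  have [c] := MVT_segment (ltW y0) (fun x _ => dg x) (cg _).
  rewrite in_itv/= g0 !sub0r mulrN => /andP[c0 cy] /oppr_inj e.
  by exists c => //; rewrite !ler0_norm ?lerN2// ltW.
rewrite ec normrM exprSr mulrA; apply: ler_pM => //.
  apply: le_trans (gA c) _; apply: ler_wpM2l => //.
  by apply: lerXn2r; rewrite ?nnegrE ?addr_ge0// lerD2l.
by rewrite lerDr.
Qed.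

Lemma vanishing_growth g N M A : rsmooth g -> (M < N)%N ->
  (forall k, (k <= M)%N -> derive1n k g 0 = 0) ->
  (forall y, `|derive1n M.+1 g y| <= A * (1 + `|y|) ^+ (N - M.+1)) ->
  forall k, (k <= M.+1)%N ->
    forall y, `|derive1n k g y| <= A * (1 + `|y|) ^+ (N - k).
Proof.
(* Induction on the distance [M.+1 - k], hence downward from order M+1; [M < N] makes the truncated
   exponent [N - k] grow by exactly one at each step. *)
move=> sg MN g0 gA k kM; rewrite -(subKn kM).
elim: (M.+1 - k)%N (leq_subr k M.+1) => [|j IH] jM; first by rewrite subn0.
have e : (M.+1 - j = (M.+1 - j.+1).+1)%N by rewrite subnSK.
have e2 : (N - (M.+1 - j.+1) = (N - (M.+1 - j)).+1)%N.
  by rewrite e subnSK// (leq_trans _ MN)// -e leq_subr.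
rewrite e2; apply: mean_value_growth => //.
  by apply: g0; rewrite subSS leq_subr.
by rewrite -e; apply: IH; exact: ltnW.
Qed.

(* One factor s is cancelled here against s^-1 in h_w,s: see
   taylor_remainder_rescale. *)
Definition taylor_remainder h M s w y :=
  s ^+ M * h (- s^-1 * y + w) -
  \sum_(0 <= n < M.+1)
    s ^+ M * ((-1) ^+ n / n`!%:R * s ^- n * derive1n n h w) * y ^+ n.

Lemma derive1n_taylor_remainder h M s w k : rsmooth h ->
  rsmooth (taylor_remainder h M s w) /\
  derive1n k (taylor_remainder h M s w) = fun y =>
    s ^+ M * ((- s^-1) ^+ k * derive1n k h (- s^-1 * y + w)) -
    \sum_(0 <= n < M.+1) s ^+ M * ((-1) ^+ n / n`!%:R * s ^- n * derive1n n h w)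
       * ((n ^_ k)%:R * y ^+ (n - k)).
Proof.
move=> sh.
have [sp dp] := derive1n_power_sum
  (fun n => s ^+ M * ((-1) ^+ n / n`!%:R * s ^- n * derive1n n h w)) M.+1 k.
have sa := rsmooth_affine (c := - s^-1) (d := w) sh.
have -> : taylor_remainder h M s w = fun y => s ^+ M * h (- s^-1 * y + w) +
   (-1) * (\sum_(0 <= n < M.+1)
     s ^+ M * ((-1) ^+ n / n`!%:R * s ^- n * derive1n n h w) * y ^+ n).
  by apply/funext => y; rewrite mulN1r.
split; first exact: rsmooth_lin sa sp.
rewrite (derive1n_lin _ _ _ sa sp) dp (derive1n_affine _ _ _ sh).
by apply/funext => y; rewrite mulN1r.
Qed.

(** At 0 only the term n = k of the differentiated sum survives: [n ^_ k] kills n < k and 0^(n-k)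
    kills n > k. The survivor cancels the chain-rule term, whose factor is (-1/s)^k. *)
Lemma taylor_remainder_vanish h M s w k : rsmooth h -> (k <= M)%N ->
  derive1n k (taylor_remainder h M s w) 0 = 0.
Proof.
move=> sh kM; rewrite (derive1n_taylor_remainder h M s w k sh).2 mulr0 add0r.
rewrite (bigD1_seq k) ?iota_uniq ?mem_index_iota//= big1 ?addr0 => [|n nk].
  have f0 : k`!%:R != 0 :> R by rewrite pnatr_eq0 -lt0n fact_gt0.
  rewrite subnn expr0 mulr1 ffactnn -mulrA -mulrBr (exprNn s^-1) exprVn.
  move: (s ^- k) ((-1) ^+ k) => a e.
  by rewrite [X in _ * X](_ : _ = 0) ?mulr0//; field.
have [kn|nk'|/eqP] := ltngtP k n; last by rewrite eq_sym (negbTE nk).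
  by rewrite expr0n subn_eq0 leqNgt kn !mulr0.
by rewrite ffact_small// mul0r mulr0.
Qed.

(** Put u = w - y/s. Then 1 + |u| <= (1 + W) (1 + |y|) and 1 + |y| <= s (1 + W) (1 + |u|). For k <=
    N the first suffices, as s^(M-k) <= 1/s by M < k. For k > N the second costs s^(k-N), and
    s^(M-N) <= 1/s by M < N. *)
Lemma weight_dilation (N M k : nat) (W : R) : (M < N)%N -> (M < k)%N ->
  exists2 K : R, 0 <= K & forall s w y, 1 <= s -> `|w| <= W ->
    s ^+ M * s ^- k * (1 + `|y|) ^ (- (N%:Z - k%:Z)) <=
    K / s * (1 + `|- s^-1 * y + w|) ^ (- (N%:Z - k%:Z)).
Proof.
move=> MN Mk.
(* Subtraction is truncated, so the exponent is |k - N| and serves both cases. *)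
exists ((1 + `|W|) ^+ (k - N + (N - k))) => [|s w y s1 wW].
  by rewrite exprn_ge0 ?addr_ge0.
have s0 : 0 < s by exact: lt_le_trans s1.
have W0 : 0 <= W by exact: le_trans wW.
rewrite (ger0_norm W0).
set u := - s^-1 * y + w.
have uy : 1 + `|u| <= (1 + W) * (1 + `|y|).
  have : `|u| <= `|y| + W.
    apply: (le_trans (ler_normD _ _)); apply: lerD => //.
    rewrite normrM normrN normfV (gtr0_norm s0).
    by rewrite ler_piMl// invf_le1.
  by have := normr_ge0 y; nra.
have yu : 1 + `|y| <= s * (1 + W) * (1 + `|u|).
  have e : y = s * (w - u) by rewrite /u; field; rewrite gt_eqF.
  have : `|y| <= s * (W + `|u|).
    rewrite e normrM gtr0_norm// ler_pM2l//.
    by apply: (le_trans (ler_normB _ _)); rewrite lerD2r.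
  by have := normr_ge0 u; have := mulr_ge0 (ltW s0) W0; nra.
have y0 : 0 < 1 + `|y| by rewrite ltr_pwDl.
have u0 : 0 < 1 + `|u| by rewrite ltr_pwDl.
have W1 : 0 <= 1 + W by rewrite addr_ge0.
have [kN|Nk] := leqP k N.
  have -> : - (N%:Z - k%:Z) = - (N - k)%N%:Z by rewrite subzn.
  rewrite -!exprnN (eqP (_ : k - N == 0)%N) ?subn_eq0// add0n.
  rewrite ler_pdivlMr ?exprn_gt0// mulrAC ler_pdivrMr ?exprn_gt0//.
  rewrite [leRHS]mulrAC -exprMn mulrC; apply: ler_pM.
  - by rewrite exprn_ge0 // ltW.
  - by rewrite mulr_ge0 ?invr_ge0 ?exprn_ge0// ltW.
  - by apply: lerXn2r; rewrite ?nnegrE// ?mulr_ge0// ltW.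
  rewrite ler_pdivrMr ?exprn_gt0// mulrC ler_pdivlMr// -exprSr.
  exact: ler_weXn2l.
have -> : - (N%:Z - k%:Z) = (k - N)%N%:Z by rewrite opprB subzn// ltnW.
rewrite -!exprnP (eqP (_ : N - k == 0)%N) ?subn_eq0 ?(ltnW Nk)// addn0.
have : (1 + `|y|) ^+ (k - N) <= (s * (1 + W) * (1 + `|u|)) ^+ (k - N).
  by apply: lerXn2r; rewrite ?nnegrE// ?mulr_ge0// ltW.
move=> /(ler_wpM2l (_ : 0 <= s ^+ M * s ^- k)) -/(_ _) h.
apply: (le_trans (h _)); first by rewrite mulr_ge0 ?invr_ge0 ?exprn_ge0// ltW.
rewrite !exprMn 2!mulrA; apply: ler_wpM2r; first by rewrite exprn_ge0// ltW.
rewrite mulrC; apply: ler_wpM2l; first by rewrite exprn_ge0.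
rewrite mulrAC ler_pdivrMr ?exprn_gt0// [leRHS]mulrC ler_pdivlMr// -exprD -exprSr.
by apply: ler_weXn2l => //; rewrite -addSn -{2}(subnKC (ltnW Nk)) leq_add2r.
Qed.

Lemma taylor_remainder_bound h (N M k : nat) (W : R) : rsmooth h -> (M < N)%N ->
  (forall n, exists B, forall x,
     (1 + `|x|) ^ (- (N%:Z - n%:Z)) * `|derive1n n h x| <= B) ->
  exists2 C : R, 0 <= C & forall s w y, 1 <= s -> `|w| <= W ->
    (1 + `|y|) ^ (- (N%:Z - k%:Z)) * `|derive1n k (taylor_remainder h M s w) y|
      <= C / s.
Proof.
move=> sh MN hB.
(* Orders k <= M follow from order M+1: as M+1 <= N, the weights are inverse natural powers, and
   [vanishing_growth] carries the bound down with the same constant. *)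
wlog Mk : k / (M < k)%N => [high|].
  have [//|kM] := ltnP M k; first exact: high.
  have [C C0 hC] := high M.+1 (ltnSn M).
  exists C => // s w y s1 wW.
  have y0 : 0 < 1 + `|y| by rewrite ltr_pwDl.
  have -> : - (N%:Z - k%:Z) = - (N - k)%N%:Z.
    by rewrite subzn// (leq_trans kM)// ltnW.
  rewrite -exprnN mulrC ler_pdivrMr ?exprn_gt0//.
  have sR := (derive1n_taylor_remainder h M s w 0 sh).1.
  have g0 j : (j <= M)%N -> derive1n j (taylor_remainder h M s w) 0 = 0.
    exact: taylor_remainder_vanish.
  apply: (vanishing_growth _ N M _ sR MN g0 _ _ (leqW kM)) => x.
  have := hC s w x s1 wW.
  by rewrite subzn// -exprnN mulrC ler_pdivrMr// exprn_gt0// ltr_pwDl.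
have [B hBk] := hB k; have [K K0 hK] := weight_dilation N M k W MN Mk.
have B0 : 0 <= B.
  by apply: (le_trans _ (hBk 0)); rewrite mulr_ge0// exprz_ge0// addr_ge0.
exists (K * B) => [|s w y s1 wW]; first exact: mulr_ge0.
have s0 : 0 < s by exact: lt_le_trans s1.
(* More than M derivatives annihilate the Taylor polynomial; only the dilated derivative of [h]
   remains. *)
rewrite (derive1n_taylor_remainder h M s w k sh).2 big_nat big1 => [|n /andP[_ nM]].
  rewrite subr0 !normrM !normrX normrN normfV (gtr0_norm s0) exprVn.
  have := ler_wpM2r (normr_ge0 (derive1n k h (- s^-1 * y + w))) (hK s w y s1 wW).
  rewrite (mulrA (s ^+ M)) mulrA (mulrC (_ ^ _)) => /le_trans; apply.
  rewrite -(mulrA (K / s)) [leRHS]mulrAC; apply: ler_wpM2l.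
    by rewrite divr_ge0 ?(ltW s0).
  exact: hBk.
by rewrite ffact_small ?mul0r ?mulr0// (leq_trans _ Mk).
Qed.

End taylor_remainder.

(** * Continuity of functionals in terms of finitely many seminorms *)

Section continuous_functionals.
Context {R : realType} {N : nat}.

(** A pointwise real bound on the seminorms through order [L]; such sets fit inside every basic
    neighbourhood of 0. *)
Definition MN_bounded_by (L : nat) (d : R) (phi : MN R N) :=
  forall n, (n <= L)%N -> forall x,
    (1 + `|x|) ^ (- (N%:Z - n%:Z)) * normc (cderive1n n phi x) <= d.

Lemma MN_bounded_by_le L1 L2 d1 d2 phi : (L1 <= L2)%N -> d2 <= d1 ->
  MN_bounded_by L2 d2 phi -> MN_bounded_by L1 d1 phi.
Proof.
move=> L12 d21 h n nL x; apply: le_trans d21; apply: h.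
exact: leq_trans L12.
Qed.

(** The centre c of the ball need not be 0, but the seminorm of -c lies below the radius, and the
    triangle inequality spends the slack. *)
Lemma MN_ball_bounded (i : MN R N * nat * R) : MN_ball i 0 ->
  exists2 d : R, 0 < d & forall phi, MN_bounded_by i.1.2 d phi -> MN_ball i phi.
Proof.
case: i => [[c n] r]; rewrite /MN_ball /= sub0r => hc.
have ub x : (((1 + `|x|) ^ (- (N%:Z - n%:Z)) * normc (cderive1n n (- c)%R x))%:E
    <= MN_norm N n (- c)%R)%E by apply: ereal_sup_ubound; exists x.
have [t tr hcx] : exists2 t : R, t < r & forall x,
    (1 + `|x|) ^ (- (N%:Z - n%:Z)) * normc (cderive1n n (- c) x) <= t.
  case: (MN_norm N n (- c)) hc ub => [t|//|_ /(_ 0)]; last by rewrite leeNy_eq.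
  by rewrite lte_fin => tr ub; exists t => // x; rewrite -lee_fin.
(* Half of the slack keeps the supremum at most (r + t) / 2, strictly below r. *)
exists ((r - t) / 2) => [|phi hphi]; first by rewrite divr_gt0// subr_gt0.
apply: (@le_lt_trans _ _ ((r + t) / 2)%:E); last first.
  by rewrite lte_fin ltr_pdivrMr// mulr_natr mulr2n ltrD2l.
rewrite -[leLHS]/(MN_norm N n (phi - c)%R); apply: ge_ereal_sup => _ [x _ <-].
rewrite lee_fin.
have [[/MN_predP [sphi _]] [/MN_predP [sc _]]] := (valP phi, valP (- c)).
have -> : MN_fun (phi - c) = 1 *: MN_fun phi + MN_fun (- c).
  by rewrite scale1r.
rewrite (cderive1n_lin 1 n sphi sc) mul1r.
apply: le_trans (ler_wpM2l (weight_ge0 _ _) (normcD_le _ _)) _.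
have := hphi n (leqnn _) x; have := hcx x; rewrite mulrDr.
by move: (_ * _) (_ * _) => a b; lra.
Qed.

(** A finite intersection is handled by taking the largest order and the smallest radius. *)
Lemma MN_basic_open_bounded (A : set (MN R N)) :
  finI_from [set j | 0 < j.2] (@MN_ball R N) A -> A 0 ->
  exists L, exists2 d : R, 0 < d & forall phi, MN_bounded_by L d phi -> A phi.
Proof.
case=> E _ EA A0.
have sub phi : (forall j, j \in enum_fset E -> MN_ball j phi) -> A phi.
  by move=> h; rewrite -EA => j /= jE; exact: h.
have h0 j : j \in enum_fset E -> MN_ball j (0 : MN R N).
  by move=> jE; move: A0; rewrite -EA; apply.
suff [L [d d0 hd]] : exists L, exists2 d : R, 0 < d &
    forall phi, MN_bounded_by L d phi ->
      forall j, j \in enum_fset E -> MN_ball j phi.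
  by exists L, d => // phi /hd; exact: sub.
elim: (enum_fset E) h0 => [|k u IHu] h0; first by exists 0%N, 1.
have [|L [d d0 hd]] := IHu; first by move=> l lu; apply: h0; rewrite inE lu orbT.
have [e e0 he] := MN_ball_bounded k (h0 k (mem_head _ _)).
exists (maxn L k.1.2), (Num.min d e) => [|phi hphi l]; first by rewrite lt_min d0.
rewrite inE => /predU1P[->|lu].
  apply: he; apply: MN_bounded_by_le hphi; first exact: leq_maxr.
  by rewrite ge_min lexx orbT.
apply: hd lu; apply: MN_bounded_by_le hphi; first exact: leq_maxl.
by rewrite ge_min lexx.
Qed.

Lemma normC_normc (z : R[i]^o) : `|z| = (normc z)%:C.
Proof. by []. Qed.

Lemma MN_continuous_small (f : {linear MN R N -> R[i]^o}) (e : R) :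
  continuous f -> 0 < e ->
  exists L, exists2 d : R, 0 < d &
    forall phi, MN_bounded_by L d phi -> normc (f phi) < e.
Proof.
move=> cf e0.
have ball0 : nbhs (f 0) (ball (0 : R[i]^o) e%:C).
  by rewrite linear0; apply: nbhsx_ballx; rewrite ltcR.
have := cf 0 _ ball0; rewrite nbhsE => -[B [oB B0] BA].
(* An open set is a union of finite intersections of balls; [A] is a member of that union containing
   0. *)
case: oB => D sD eB; move: B0 BA; rewrite -eB => -[A DA A0] BA.
have [L [d d0 hd]] := MN_basic_open_bounded A (sD A DA) A0.
exists L, d => // phi /hd Aphi.
have : ball (0 : R[i]^o) e%:C (f phi) by apply: BA; exists A.
by rewrite -ball_normE /= sub0r normrN normC_normc ltcR.
Qed.

End continuous_functionals.

(** * The rescaled error as the value of the functional at a test function *)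

Section moment_expansion.
Context {R : realType} {N : nat}.
Implicit Types (psi phi : MN R N) (s w y x : R).

Lemma taylor_remainder_rescale (h : R -> R) M s w y : s != 0 ->
  s ^+ M.+1 * (s^-1 * h ((s * w - y) / s) -
    \sum_(0 <= n < M.+1)
      (-1) ^+ n / n`!%:R * s ^- n.+1 * y ^+ n * derive1n n h w) =
  taylor_remainder h M s w y.
Proof.
move=> s0; have -> : (s * w - y) / s = - s^-1 * y + w by field.
rewrite /taylor_remainder mulrBr; congr (_ - _).
  by rewrite exprSr mulrA mulfK.
rewrite mulr_sumr; apply: eq_bigr => n _.
rewrite !exprSr invfM; move: (s ^+ M) ((-1) ^+ n / n`!%:R) (s ^- n) => a b c.
by field.
Qed.

Lemma MN_fun_sum (r : seq nat) (c : nat -> R[i]) (p : nat -> MN R N) y :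
  (\sum_(n <- r) c n *: p n : MN R N) y = \sum_(n <- r) c n * p n y.
Proof.
elim: r => [|n r IH]; first by rewrite !big_nil.
by rewrite !big_cons -IH.
Qed.

Lemma sum_complex (r : seq nat) (c u v : nat -> R) :
  \sum_(n <- r) (c n)%:C * (u n +i* v n) =
  (\sum_(n <- r) c n * u n) +i* (\sum_(n <- r) c n * v n).
Proof.
elim: r => [|n r IH]; first by rewrite !big_nil.
by rewrite !big_cons IH /=; simpc.
Qed.

(* For n <= M < N and 0 < s the default values of insubd are not used. *)
Definition moment_test psi (M : nat) s w : MN R N :=
  (s ^+ M.+1)%:C *: (insubd (0 : MN R N) (fun y => dilate s psi (s * w - y)) -
    \sum_(0 <= n < M.+1)
      ((-1) ^+ n / n`!%:R * (s ^- n.+1)%:C * cderive1n n psi w) *: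
        insubd (0 : MN R N) (monomial n)).

(** All coefficients other than the derivatives of [psi] are real, so the test function splits into
    two real Taylor remainders. *)
Lemma moment_testE psi M s w : 0 < s -> (M < N)%N ->
  MN_fun (moment_test psi M s w) = fun y =>
    taylor_remainder (re \o psi) M s w y +i* taylor_remainder (im \o psi) M s w y.
Proof.
move=> s0 ltMN; have sn0 : s != 0 by rewrite gt_eqF.
apply/funext => y.
have -> : moment_test psi M s w y = (s ^+ M.+1)%:C *
    ((insubd (0 : MN R N) (fun y => dilate s psi (s * w - y))) y -
     (\sum_(0 <= n < M.+1)
       ((-1) ^+ n / n`!%:R * (s ^- n.+1)%:C * cderive1n n psi w) *:
        insubd (0 : MN R N) (monomial n) : MN R N) y) by [].
rewrite MN_fun_sum.
have -> : MN_fun (insubd (0 : MN R N) (fun y => dilate s psi (s * w - y))) =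
    fun y => dilate s psi (s * w - y).
  by rewrite -[LHS]/(\val _) val_insubd (dilate_in _ s0 (valP psi)).
rewrite (eq_big_nat _ _ (F2 := fun n =>
    ((-1) ^+ n / n`!%:R * s ^- n.+1 * y ^+ n)%:C * 
      (derive1n n (re \o psi) w +i* derive1n n (im \o psi) w))); last first.
  move=> n /andP[_ nM].
  rewrite -[MN_fun _]/(\val _) val_insubd.
  rewrite (@monomial_in R N n (ltnW (leq_trans nM ltMN))).
  rewrite /monomial !rmorphM !fmorphV !rmorphXn rmorphN1 rmorph_nat mulrAC.
  by [].
rewrite sum_complex -!taylor_remainder_rescale// /dilate /=.
case: (psi _) => a b; simpc.
by [].
Qed.

(** By linearity of [f]: convolution and moments are its values at the same [insubd] elements. *)
Lemma moment_test_pairing (f : {linear MN R N -> R[i]^o}) psi M s w :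
  f (moment_test psi M s w) =
  (s ^+ M.+1)%:C * (convolution f (dilate s psi) (s * w) -
    \sum_(0 <= n < M.+1)
      (-1) ^+ n / n`!%:R * moment f n * (s ^- n.+1)%:C * cderive1n n psi w).
Proof.
rewrite /moment_test linearZ linearB linear_sum; congr (_ * (_ - _)).
apply: eq_bigr => n _; rewrite linearZ /moment /pairing.
rewrite -[LHS]/(_ * _).
by rewrite mulrAC; congr (_ * _); rewrite mulrAC.
Qed.

Lemma normc_le_add (a b : R) : normc (a +i* b) <= `|a| + `|b|.
Proof.
have -> : a +i* b = a%:C + 0 +i* b by simpc.
apply: le_trans (normcD_le _ _) _.
by rewrite /= !expr0n addr0 add0r !sqrtr_sqr.
Qed.

Lemma moment_test_bound psi M (W : R) L : (M < N)%N ->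
  exists2 C : R, 0 <= C & forall s w, 1 <= s -> `|w| <= W ->
    MN_bounded_by L (C / s) (moment_test psi M s w).
Proof.
move=> ltMN; have /MN_predP[[sr si] hpsi] := valP psi.
have hB n : exists B, forall x,
    (1 + `|x|) ^ (- (N%:Z - n%:Z)) * normc (cderive1n n psi x) <= B.
  exact/MN_norm_ltyP/hpsi.
have hr n : exists B, forall x,
    (1 + `|x|) ^ (- (N%:Z - n%:Z)) * `|derive1n n (re \o psi) x| <= B.
  have [B hBn] := hB n; exists B => x; apply: le_trans (hBn x).
  apply: ler_wpM2l; first exact: weight_ge0.
  by rewrite /= -sqrtr_sqr ler_wsqrtr// lerDl sqr_ge0.
have hi n : exists B, forall x,
    (1 + `|x|) ^ (- (N%:Z - n%:Z)) * `|derive1n n (im \o psi) x| <= B.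
  have [B hBn] := hB n; exists B => x; apply: le_trans (hBn x).
  apply: ler_wpM2l; first exact: weight_ge0.
  by rewrite /= -sqrtr_sqr ler_wsqrtr// lerDr sqr_ge0.
(* One order at a time: the bounds for the real and imaginary remainders add up. *)
have one k : exists2 C : R, 0 <= C & forall s w, 1 <= s -> `|w| <= W -> forall y,
    (1 + `|y|) ^ (- (N%:Z - k%:Z)) *
      normc (cderive1n k (moment_test psi M s w) y) <= C / s.
  have [C1 C10 h1] := taylor_remainder_bound _ N M k W sr ltMN hr.
  have [C2 C20 h2] := taylor_remainder_bound _ N M k W si ltMN hi.
  exists (C1 + C2) => [|s w s1 wW y]; first exact: addr_ge0.
  rewrite moment_testE ?ltMN ?(lt_le_trans _ s1)// mulrDl.
  apply: le_trans (lerD (h1 s w y s1 wW) (h2 s w y s1 wW)).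
  by rewrite -mulrDr; apply: ler_wpM2l; [exact: weight_ge0|exact: normc_le_add].
(* Adding the constants of the finitely many orders gives one that dominates them all. *)
elim: L => [|L [C C0 hC]].
  have [C C0 hC] := one 0%N; exists C => // s w s1 wW n.
  by rewrite leqn0 => /eqP ->; exact: hC.
have [C' C'0 hC'] := one L.+1; exists (C + C') => [|s w s1 wW n].
  exact: addr_ge0.
have s0 : 0 <= s^-1 by rewrite invr_ge0 (le_trans _ s1).
rewrite mulrDl leq_eqVlt => /predU1P[->|nL] x.
  by apply: (le_trans (hC' s w s1 wW x)); rewrite lerDr mulr_ge0.
by apply: (le_trans (hC s w s1 wW n nL x)); rewrite lerDl mulr_ge0.
Qed.

End moment_expansion.

(** * Uniform convergence on compact sets *)

Theorem theorem6 (R : realType) (N M : nat) (hN : (1 <= N)%N)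
    (hM : (M <= N - 1)%N) (f : {linear MN R N -> R[i]^o})
    (f_cont : continuous f) (psi : MN R N) :
  {family compact,
    (fun (sigma w : R) =>
       (sigma ^+ M.+1)%:C *
       (convolution f (dilate sigma psi) (sigma * w) -
        \sum_(0 <= n < M.+1)
          (-1) ^+ n / n`!%:R * moment f n * (sigma ^- n.+1)%:C
          * cderive1n n psi w) : R[i]^o) @ +oo --> (fun=> 0)}.
Proof.
have ltMN : (M < N)%N by rewrite -(subnK hN) addn1 ltnS.
apply/fam_cvgP => K cK P /uniform_nbhs[E [entE EP]].
have [e e0 eE] : exists2 e : R, 0 < e &
    forall z : R[i]^o, normc z < e -> E (0, z).
  (* Radii are complex here; positivity in [R[i]] forces the imaginary part to vanish, so the radius
     is a positive real. *)
  move: entE; rewrite -entourage_from_ballE => -[[a b]] /=.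
  rewrite ltcE /= => /andP[/eqP b0 a0] sE; exists a => // z za.
  apply: sE => /=; rewrite -ball_normE /= sub0r normrN normC_normc b0.
  by rewrite ltcR.
have [L [d d0 hd]] := MN_continuous_small f e f_cont e0.
have [W hW] : exists W : R, forall w, K w -> `|w| <= W.
  have [W [_ hW]] := compact_bounded cK.
  by exists (W + 1) => w Kw; apply: hW => //; rewrite ltrDl.
have [C C0 hC] := moment_test_bound psi M W L ltMN.
apply: filterS EP _.
(* The first condition is the range where the seminorm bounds hold; the second turns C/s into at
   most d. *)
have near_s : \forall s \near +oo, 1 <= s /\ C / d <= s.
  by apply: filterI; apply: nbhs_pinfty_ge; rewrite num_real.
apply: filterS near_s => s [s1 sC] w Kw.
rewrite -moment_test_pairing; apply/eE/hd.
apply: MN_bounded_by_le (hC s w s1 (hW w Kw)) => //.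
rewrite ler_pdivrMr ?(lt_le_trans _ s1)//.
by rewrite mulrC -ler_pdivrMr.
Qed.
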